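(* Let the realization behavior $\mathfrak B_\infty$ of the linear time-invariant system with matrices $A,\widetilde B,C,\widetilde D$ and state dimension $n_x$ be controllable. Let $T,L\in\mathbb Z_+$ and let $(v,y)\in\mathfrak B_{T-1}^{\text{i/o}}$ be such that $v$ is persistently exciting of order $L+n_x$. Then the following statements hold: (i) $(\tilde{\mathsf v},\tilde{\mathsf y})\in\mathfrak C_{L-1}^{\text{i/o}}$ if and only if there is $\mathsf g\in\ell^2(\mathbb R^{T-L+1})$ such that $$\begin{bmatrix}\tilde{\mathsf v}^i_{[0,L-1]}\\ \tilde{\mathsf y}^i_{[0,L-1]}\end{bmatrix}=\begin{bmatrix}\mathcal H_L(\mathbf v_{[0,T-1]})\\ \mathcal H_L(\mathbf y_{[0,T-1]})\end{bmatrix}\mathsf g^i\qquad\text{for all } i\in\mathbb N.$$ (ii) $(\tilde V,\tilde Y)\in\mathfrak S_{L-1}^{\text{i/o}}$ if and only if there is $G\in L^2(\Omega,\mathbb R^{T-L+1})$ such that $$\begin{bmatrix}\tilde{\mathbf V}_{[0,L-1]}\\ \tilde{\mathbf Y}_{[0,L-1]}\end{bmatrix}=\begin{bmatrix}\mathcal H_L(\mathbf v_{[0,T-1]})\\ \mathcal H_L(\mathbf y_{[0,T-1]})\end{bmatrix}G.$$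
   Context: $\mathbb N=\{0,1,2,\dots\}$, $\mathbb Z_+=\{1,2,\dots\}$. Fix real matrices $A\in\mathbb R^{n_x\times n_x}$, $\widetilde B\in\mathbb R^{n_x\times n_v}$, $C\in\mathbb R^{n_y\times n_x}$, $\widetilde D\in\mathbb R^{n_y\times n_v}$. Realization behavior: $\mathfrak B_\infty$ is the set of all $(x,v,y)$ with $x\in(\mathbb R^{n_x})^{\mathbb N}$, $v\in(\mathbb R^{n_v})^{\mathbb N}$, $y\in(\mathbb R^{n_y})^{\mathbb N}$ such that $x_{k+1}=Ax_k+\widetilde Bv_k$ and $y_k=Cx_k+\widetilde Dv_k$ for all $k\in\mathbb N$. It is controllable if for all $b,\tilde b\in\mathfrak B_\infty$ and every $T\in\mathbb Z_+$ there exist $b'\in\mathfrak B_\infty$ and $T'\in\mathbb N$ with $b'_k=b_k$ for $0\le k\le T-1$ and $b'_{T+T'+k}=\tilde b_k$ for all $k\in\mathbb N$. Probability space: $(\Omega,\mathcal F,\mathbb P)$ is a separable probability space. $L^2(\Omega,\mathbb R^d)$ is the Hilbert space of (equivalence classes of) $\mathbb R^d$-valued random variables of finite variance; equality means equality for $\mathbb P$-almost all $\omega$. $\ell^2(\mathbb R^d)=\{\mathsf z\in(\mathbb R^d)^{\mathbb N}:\sum_i(\mathsf z^i)^\top\mathsf z^i<\infty\}$. Expansion coefficient behavior: for $\mathsf z=((\mathsf z_k^i)_{i\in\mathbb N})_{k\in\mathbb N}$ ($k$ time, $i$ expansion index) write $\mathsf z^i=(\mathsf z_k^i)_{k\in\mathbb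 N}$. $\mathfrak C_\infty$ is the set of all $(\mathsf x,\mathsf v,\mathsf y)$ with $\mathsf x\in(\ell^2(\mathbb R^{n_x}))^{\mathbb N}$, $\mathsf v\in(\ell^2(\mathbb R^{n_v}))^{\mathbb N}$, $\mathsf y\in(\ell^2(\mathbb R^{n_y}))^{\mathbb N}$ such that $(\mathsf x^i,\mathsf v^i,\mathsf y^i)\in\mathfrak B_\infty$ for all $i$. Random variable behavior: $\mathfrak S_\infty$ is the set of all $(X,V,Y)$ with $X\in(L^2(\Omega,\mathbb R^{n_x}))^{\mathbb N}$, $V\in(L^2(\Omega,\mathbb R^{n_v}))^{\mathbb N}$, $Y\in(L^2(\Omega,\mathbb R^{n_y}))^{\mathbb N}$ such that $(X(\omega),V(\omega),Y(\omega))\in\mathfrak B_\infty$ for $\mathbb P$-almost all $\omega$. Manifest behaviors: $\mathfrak B_\infty^{\text{i/o}}$ is the set of $(v,y)$ for which there is $x\in(\mathbb R^{n_x})^{\mathbb N}$ with $(x,v,y)\in\mathfrak B_\infty$; $\mathfrak C_\infty^{\text{i/o}}$ is the set of $(\mathsf v,\mathsf y)$ for which there is $\mathsf x\in(\ell^2(\mathbb R^{n_x}))^{\mathbb N}$ with $(\mathsf x,\mathsf v,\mathsf y)\in\mathfrak C_\infty$; $\mathfrak S_\infty^{\text{i/o}}$ is the set of $(V,Y)$ for which there is $X\in(L^2(\Omega,\mathbb R^{n_x}))^{\mathbb N}$ with $(X,V,Y)\in\mathfrak S_\infty$. For $M\in\mathbb N$ the subscript $M$ in place of $\infty$ denotes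 the set of restrictions to $\{0,\dots,M\}$ of the elements of the corresponding infinite-horizon behavior. In (i) and (ii), $(\tilde{\mathsf v},\tilde{\mathsf y})$ and $(\tilde V,\tilde Y)$ range over sequences on $\{0,\dots,L-1\}$ with values in $\ell^2(\mathbb R^{n_v})\times\ell^2(\mathbb R^{n_y})$ and $L^2(\Omega,\mathbb R^{n_v})\times L^2(\Omega,\mathbb R^{n_y})$, respectively. Stacking and Hankel matrices: $\mathbf f_{[n,m]}=[f_n^\top\ \dots\ f_m^\top]^\top$ (likewise for $\tilde{\mathsf v}^i_{[0,L-1]}$, $\tilde{\mathsf y}^i_{[0,L-1]}$). For $f:\{0,\dots,T-1\}\to\mathbb R^d$, $\mathcal H_L(\mathbf f_{[0,T-1]})\in\mathbb R^{dL\times(T-L+1)}$ is the block Hankel matrix whose $j$-th column ($j=0,\dots,T-L$) is $\mathbf f_{[j,j+L-1]}$. A signal $v:\{0,\dots,T-1\}\to\mathbb R^{n_v}$ is persistently exciting of order $M$ (where $T\ge M(n_v+1)-1$) if $\mathcal H_M(\mathbf v_{[0,T-1]})$ has row rank $n_vM$. *)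

(* Defs.v *)
(* MathComp / MathComp-Analysis *)
From HB Require Import structures.
From mathcomp Require Import all_boot all_order all_algebra.
From mathcomp Require Import all_classical all_reals all_analysis.

Set Implicit Arguments.
Unset Strict Implicit.
Unset Printing Implicit Defensive.

Import Order.TTheory GRing.Theory Num.Theory.
Import numFieldNormedType.Exports.

Local Open Scope classical_set_scope.
Local Open Scope ring_scope.

Definition traj (X V Y : Type) : Type :=
  ((nat -> X) * (nat -> V) * (nat -> Y))%type.

Definition manifest (X V Y : Type) (W : set (X * V * Y)) : set (V * Y) :=
  [set w | exists x, W (x, w.1, w.2)].

Definition restr (E : Type) (N : nat) (z : nat -> E) : 'I_N -> E :=
  fun k => z k.
Arguments restr {E} N z.

(* [restr_io N W] restricts to the N time instants 0, ..., N - 1; the behavior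
   with subscript M (horizon {0, ..., M}) is thus [restr_io M.+1 W]. *)
Definition restr_io (E F : Type) (N : nat) (W : set ((nat -> E) * (nat -> F))) :
    set (('I_N -> E) * ('I_N -> F)) :=
  [set (restr N w.1, restr N w.2) | w in W].
Arguments restr_io {E F} N W.

Section Hankel.
Variable R : realType.

(* The rows of [stack f] are indexed by 'I_(\sum_(i < N) d), i.e. by N * d rows
   in blocks of height d. *)
Definition stack (d N : nat) (f : 'I_N -> 'cV[R]_d) :
    'cV[R]_(\sum_(i < N) d) := \mxcol_(i < N) f i.

Lemma window_subproof (T L : nat) (j : 'I_(T.+1 - L)) (i : 'I_L) :
  (j + i < T)%N.
Proof.
have := ltn_ord j; rewrite ltn_subRL addnC ltnS => jL.
by apply: leq_trans jL; rewrite ltn_add2l.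
Qed.

Definition window (E : Type) (T L : nat) (f : 'I_T -> E) (j : 'I_(T.+1 - L)) :
    'I_L -> E := fun i => f (Ordinal (window_subproof j i)).

(* The number of columns T - L + 1 is written T.+1 - L, which is also correct
   (no column) when T = L - 1. *)
Definition hankel (d T : nat) (L : nat) (f : 'I_T -> 'cV[R]_d) :
    'M[R]_(\sum_(i < L) d, T.+1 - L) :=
  \matrix_(p, j) stack (window f j) p 0.

(* The first conjunct is T >= M (nv + 1) - 1. *)
Definition persistently_exciting (nv T : nat) (M : nat)
    (v : 'I_T -> 'cV[R]_nv) : Prop :=
  (M * nv.+1 <= T.+1)%N /\ \rank (hankel M v) = (nv * M)%N.

End Hankel.

Section Realization.
Variables (R : realType) (nx nv ny : nat).
Variables (A : 'M[R]_nx) (B : 'M[R]_(nx, nv)).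
Variables (C : 'M[R]_(ny, nx)) (D : 'M[R]_(ny, nv)).

Definition realization_behavior :
    set (traj 'cV[R]_nx 'cV[R]_nv 'cV[R]_ny) :=
  [set b | let: (x, v, y) := b in
    forall k, x k.+1 = A *m x k + B *m v k /\ y k = C *m x k + D *m v k].

End Realization.

Definition at_time (X V Y : Type) (b : traj X V Y) (k : nat) : X * V * Y :=
  (b.1.1 k, b.1.2 k, b.2 k).

Definition controllable (X V Y : Type) (W : set (traj X V Y)) : Prop :=
  forall b bt, W b -> W bt -> forall T : nat, (0 < T)%N ->
  exists b' (T' : nat), [/\ W b',
    forall k, (k < T)%N -> at_time b' k = at_time b k &
    forall k, at_time b' (T + T' + k) = at_time bt k].

Section ExpansionCoefficients.
Variable R : realType.

Record ell2 (d : nat) : Type := Ell2 {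
  ell2_fun :> nat -> 'cV[R]_d;
  ell2_summable :
    (\sum_(0 <= i <oo) (((ell2_fun i)^T *m ell2_fun i) 0 0)%:E < +oo)%E }.

Variables (nx nv ny : nat).
Variables (A : 'M[R]_nx) (B : 'M[R]_(nx, nv)).
Variables (C : 'M[R]_(ny, nx)) (D : 'M[R]_(ny, nv)).

Definition expansion_behavior :
    set (traj (ell2 nx) (ell2 nv) (ell2 ny)) :=
  [set c : traj (ell2 nx) (ell2 nv) (ell2 ny) |
    let: (x, v, y) := c in forall i : nat, realization_behavior A B C D
      (fun k => x k i, fun k => v k i, fun k => y k i)].

End ExpansionCoefficients.

Section RandomVariables.
Context (d : measure_display) (Omega : measurableType d) (R : realType).
Variable P : probability Omega R.

(* Separability of the pseudometric (E, F) |-> P (E `+` F) on the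
   sigma-algebra, where `+` is the symmetric difference. *)
Definition separable_probability : Prop :=
  exists S : nat -> set Omega, (forall n, measurable (S n)) /\
    forall E, measurable E -> forall e : R, 0 < e ->
      exists n, (P (E `+` S n) < e%:E)%E.

Lemma le12e : (1 <= (2%:R : R)%:E)%E.
Proof. by rewrite lee_fin ler1n. Qed.

(* Vectors of n elements of L^2(Omega, R), the latter consisting of classes of
   measurable functions modulo almost everywhere equality. *)
Definition L2 (n : nat) : Type := 'cV[LspaceType P le12e]_n.

(* Value at w of a representative. *)
Definition sample (n : nat) (X : L2 n) (w : Omega) : 'cV[R]_n :=
  \col_j (X j 0 : Omega -> R) w.

Variables (nx nv ny : nat).
Variables (A : 'M[R]_nx) (B : 'M[R]_(nx, nv)).
Variables (C : 'M[R]_(ny, nx)) (D : 'M[R]_(ny, nv)).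

Definition random_behavior :
    set (traj (L2 nx) (L2 nv) (L2 ny)) :=
  [set s : traj (L2 nx) (L2 nv) (L2 ny) |
    let: (X, V, Y) := s in {ae P, forall w, realization_behavior A B C D
      (fun k => sample (X k) w, fun k => sample (V k) w,
       fun k => sample (Y k) w)}].

End RandomVariables.

(* Main.v *)
Require Import Defs.
From HB Require Import structures.
From mathcomp Require Import all_boot all_order all_algebra.
From mathcomp Require Import all_classical all_reals all_analysis.
From mathcomp Require Import measurable_realfun zify lra.
Import Order.TTheory GRing.Theory Num.Theory.
Import numFieldNormedType.Exports.

Set Implicit Arguments.
Unset Strict Implicit.
Unset Printing Implicit Defensive.

Local Open Scope classical_set_scope.
Local Open Scope ring_scope.

(** The theorem is the fundamental lemma of Willems et al., applied at
    each expansion index or outcome, and it holds for both spaces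
    for the same reason: the Hankel matrices act linearly, and square
    summability and square integrability survive the action of fixed real
    matrices.

    Deterministic part.  Let x be a state trajectory behind the data, let n be
    the state dimension, and stack the depth-L Hankel matrix of v on top of the
    row of states x_0, ..., x_(T-L).  This matrix has full row rank
    ([willems_row_free]).  Indeed, let (eta, xi) annihilate it.  Shifting the
    window by k <= n and expressing x_(j+k) through x_j and the inputs gives
    n + 1 relations on windows of length L + n, whose state parts are
    eta A^k x_j.  Combined with the coefficients of the characteristic
    polynomial of A, the state parts cancel by Cayley-Hamilton, and persistent
    excitation forces every input coefficient to vanish.  The coefficients of
    all the shifted relations are shifts of a single sequence
    eta A^(n-1) B, ..., eta A B, eta B, xi_0, ..., xi_(L-1), 0, ..., so that
    this sequence satisfies a monic linear recurrence and is eventually zero;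
    it is therefore zero everywhere ([monic_recurrence_eq0]).  Hence xi = 0,
    and eta = 0 by controllability ([annihilator_eq0]).

    Passage to signals.  Write V_k, X_k, Y_k for the matrices with columns
    v_(j+k), x_(j+k), y_(j+k); they satisfy the system equations in k.  If g is
    given, then V_k g, X_k g, Y_k g, for all k, is a trajectory that extends
    the given window.  Conversely, a right inverse of the full-row-rank matrix,
    applied to the inputs and the initial state of a trajectory, produces a g
    with V_k g = v_k and X_0 g = x_0, and then X_k g = x_k, Y_k g = y_k follow
    along the window.  Only matrices acting on signals occur, so the argument
    is carried out once ([signal_fundamental_lemma]) for any [signal_space] and
    instantiated with square summable sequences and square integrable random
    vectors. *)

(** * Recurrences and Krylov sequences *)

(** The recurrence expresses e_p through e_(p+1), ..., e_(p+n); starting beyond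
    the support, it propagates zero downwards. *)
Lemma monic_recurrence_eq0 (K : pzRingType) (V : lmodType K) (n N : nat)
    (a : nat -> K) (e : nat -> V) :
    a n = 1 -> (forall q, (N <= q)%N -> e q = 0) ->
    (forall p, (p < N)%N -> \sum_(k < n.+1) a k *: e (p + (n - k))%N = 0) ->
  forall p, e p = 0.
Proof.
move=> an1 e0 rec p.
have [m] := ubnP (N - p)%N; elim: m p => // m IH p Npm.
have [/e0 //|pN] := leqP N p.
have := rec p pN; rewrite big_ord_recr /= an1 scale1r subnn addn0.
rewrite big1 ?add0r // => k _; rewrite IH ?scaler0 //.
rewrite -[(N - _)%N]/(N - (p + (n - k)))%N.
have := ltn_ord k; lia.
Qed.

(** Powers of A are applied by iteration on a row vector because square
    matrices form a nontrivial ring, with a power operation compatible with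
    [horner_mx], only in positive dimension. *)
Lemma cayley_hamilton_iter (K : comNzRingType) (n : nat) (A : 'M[K]_n) :
  exists2 a : nat -> K, a n = 1 & forall r : 'rV_n,
    \sum_(k < n.+1) a k *: iter k (mulmx^~ A) r = 0.
Proof.
case: n => [|n] in A *.
  by exists (fun=> 1) => // r; rewrite [LHS]thinmx0.
exists (fun k => (char_poly A)`_k) => [|r].
  by have /monicP := char_poly_monic A; rewrite lead_coefE size_char_poly.
have iterE k : iter k (mulmx^~ A) r = r *m A ^+ k.
  by elim: k => [|k IH] /=; rewrite ?mulmx1 // IH exprSr mulmxA.
transitivity (r *m horner_mx A (char_poly A)); last first.
  by rewrite Cayley_Hamilton mulmx0.
rewrite -[char_poly A in RHS]coefK poly_def rmorph_sum mulmx_sumr size_char_poly.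
apply: eq_bigr => k _.
by rewrite iterE /= linearZ rmorphXn /= horner_mx_X -scalemxAr.
Qed.

(** By Cayley-Hamilton, r A^k B with k >= n is a combination of the n preceding
    terms. *)
Lemma krylov_eq0 (K : comNzRingType) (n m : nat) (A : 'M[K]_n) (B : 'M[K]_(n, m))
    (r : 'rV_n) :
    (forall k, (k < n)%N -> iter k (mulmx^~ A) r *m B = 0) ->
  forall k, iter k (mulmx^~ A) r *m B = 0.
Proof.
have [a an1 CH] := cayley_hamilton_iter A.
move=> r0 k; have [l] := ubnP k; elim: l k => // l IH k kl.
have [/r0 //|nk] := ltnP k n.
have /(congr1 (mulmx^~ B)) := CH (iter (k - n) (mulmx^~ A) r).
rewrite /= mul0mx mulmx_suml big_ord_recr /= an1 scale1r -iterD subnKC //.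
rewrite big1 ?add0r // => i _.
rewrite -scalemxAl -iterD IH ?scaler0 //.
have := ltn_ord i; lia.
Qed.

(** Full row rank of the infinite controllability matrix [B, A B, A^2 B, ...],
    expressed by its left kernel. *)
Definition krylov_full (K : pzRingType) (nx nv : nat) (A : 'M[K]_nx)
    (B : 'M[K]_(nx, nv)) : Prop :=
  forall r : 'rV[K]_nx, (forall k, iter k (mulmx^~ A) r *m B = 0) -> r = 0.

(** * Annihilators of the data *)

Definition state_traj (K : pzRingType) (nx nv : nat) (A : 'M[K]_nx)
    (B : 'M[K]_(nx, nv)) (x : nat -> 'cV[K]_nx) (v : nat -> 'cV[K]_nv) : Prop :=
  forall k, x k.+1 = A *m x k + B *m v k.

Lemma mulmx_state_traj (K : pzRingType) (nx nv : nat) (A : 'M[K]_nx)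
    (B : 'M[K]_(nx, nv)) x v (r : 'rV_nx) (j k : nat) : state_traj A B x v ->
  r *m x (j + k)%N = iter k (mulmx^~ A) r *m x j
    + \sum_(i < k) iter (k.-1 - i) (mulmx^~ A) r *m B *m v (j + i)%N.
Proof.
move=> xv; elim: k r => [|k IH] r; first by rewrite big_ord0 addr0 addn0.
rewrite addnS xv mulmxDr !mulmxA IH -iterSr big_ord_recr /= subnn -addrA.
congr (_ + (_ + _)); apply: eq_bigr => i _.
have -> : (k - i)%N = (k.-1 - i).+1 by have := ltn_ord i; lia.
by rewrite iterSr.
Qed.

(** The heart of the proof: an annihilator of inputs and states on windows of
    length L is turned, by shifts and Cayley-Hamilton, into annihilators of
    inputs alone on windows of length L + n. *)
Lemma annihilator_eq0 (K : comNzRingType) (nx nv : nat) (A : 'M[K]_nx)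
    (B : 'M[K]_(nx, nv)) x v (T L : nat) (eta : 'rV[K]_nx)
    (xi : nat -> 'rV[K]_nv) :
    state_traj A B x v ->
    krylov_full A B ->
    (forall c : nat -> 'rV[K]_nv,
      (forall j, (j + (L + nx) <= T)%N ->
        \sum_(p < L + nx) c p *m v (j + p)%N = 0) ->
      forall p, (p < L + nx)%N -> c p = 0) ->
    (forall j, (j + L <= T)%N ->
      eta *m x j + \sum_(i < L) xi i *m v (j + i)%N = 0) ->
  eta = 0 /\ forall i, (i < L)%N -> xi i = 0.
Proof.
move=> xv ctrl pe ann.
(* The k-th shift of the annihilator has input coefficients e (p + (nx - k)). *)
pose e q := if (q < nx)%N then iter (nx.-1 - q) (mulmx^~ A) eta *m B
            else if (q < nx + L)%N then xi (q - nx)%N else 0.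
have shift j k : (j + (L + nx) <= T)%N -> (k <= nx)%N ->
    \sum_(p < L + nx) e (p + (nx - k))%N *m v (j + p)%N
    = - (iter k (mulmx^~ A) eta *m x j).
  move=> jT knx; have := ann (j + k)%N; rewrite (mulmx_state_traj _ _ _ xv).
  move=> /(_ ltac:(lia)) /eqP; rewrite -addrA addr_eq0 => /eqP ->.
  rewrite opprK -(big_mkord xpredT (fun p => e (p + (nx - k))%N *m v (j + p)%N)).
  (* Split at k and k + L: Krylov part, xi part, and zero tail. *)
  rewrite (@big_cat_nat _ _ _ k) //=; last lia.
  rewrite (@big_cat_nat _ _ _ (k + L) k) //=; [|lia|lia].
  rewrite [X in _ + (_ + X)]big_nat_cond [X in _ + (_ + X)]big1 => [|p];
    last first.
    rewrite andbT => /andP[kLp pL].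
    by rewrite /e ltnNge ifF ?ltnNge ?ifF ?mul0mx //; lia.
  rewrite addr0; congr (_ + _).
    rewrite big_mkord; apply: eq_bigr => i _; have ik := ltn_ord i.
    rewrite /e ifT; last lia.
    by have -> : (nx.-1 - (i + (nx - k)) = k.-1 - i)%N by lia.
  rewrite -{1}[k]add0n big_addn big_mkord addKn; apply: eq_bigr => i _.
  have iL := ltn_ord i; rewrite /e ifF ?ifT; try lia.
  by have [-> ->] :
    (i + k + (nx - k) - nx = i /\ j + (i + k) = j + k + i)%N by lia.
have [a an1 CH] := cayley_hamilton_iter A.
have e0 p : e p = 0.
  apply: (monic_recurrence_eq0 an1 (N := (L + nx)%N)) p => [q Nq|].
    by rewrite /e !ifF //; lia.
  apply: (pe (fun p => \sum_(k < nx.+1) a k *: e (p + (nx - k))%N)) => j jT.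
  transitivity (\sum_(k < nx.+1) a k *: \sum_(p < L + nx)
      e (p + (nx - k))%N *m v (j + p)%N).
    under eq_bigr do rewrite mulmx_suml.
    rewrite exchange_big /=; apply: eq_bigr => k _.
    by rewrite scaler_sumr; apply: eq_bigr => p _; rewrite scalemxAl.
  under eq_bigr => k _ do rewrite shift ?leq_ord // scalerN scalemxAl.
  by rewrite sumrN -mulmx_suml CH mul0mx oppr0.
split=> [|i iL].
  apply/ctrl/krylov_eq0 => k knx.
  have := e0 (nx.-1 - k)%N; rewrite /e ifT; last lia.
  by rewrite subKn //; lia.
have := e0 (nx + i)%N; rewrite /e ifF ?ifT; try lia.
by rewrite addKn.
Qed.

(** * Full row rank of the data matrix *)

(** The k-th block row of a Hankel matrix with N columns. *)
Definition slab (R : pzRingType) (N m : nat) (f : nat -> 'cV[R]_m) (k : nat) :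
  'M[R]_(m, N) := \matrix_(p, j) f (j + k)%N p 0.

Lemma slabE (R : pzRingType) (N m : nat) (f : nat -> 'cV[R]_m) k i (j : 'I_N) :
  slab N f k i j = f (j + k)%N i 0.
Proof. by rewrite mxE. Qed.

Lemma mulmx_slab (R : pzRingType) (N m p : nat) (M : 'M[R]_(p, m))
    (f : nat -> 'cV[R]_m) k : M *m slab N f k = slab N (fun i => M *m f i) k.
Proof.
apply/matrixP => i j; rewrite !mxE.
by apply: eq_bigr => q _; rewrite mxE.
Qed.

Lemma hankel_slab (R : realType) (m T L : nat) (f : nat -> 'cV[R]_m) :
  hankel L (restr T f) = \mxcol_(k < L) slab (T.+1 - L) f k.
Proof. by apply/matrixP => p j; rewrite !mxE. Qed.

(** Connecting the zero trajectory to the free trajectory through an arbitrary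
    state z reaches z from the origin; a row that kills all A^k B kills every
    state reachable from the origin. *)
Lemma controllable_krylov_full (R : realType) (nx nv ny : nat)
    (A : 'M[R]_nx) (B : 'M[R]_(nx, nv)) (C : 'M[R]_(ny, nx)) (D : 'M[R]_(ny, nv)) :
    controllable (realization_behavior A B C D) ->
  krylov_full A B.
Proof.
move=> ctrl r rB.
pose free z : traj 'cV[R]_nx 'cV[R]_nv 'cV[R]_ny :=
  (fun k => iter k (mulmx A) z, fun=> 0, fun k => C *m iter k (mulmx A) z).
have freeP z : realization_behavior A B C D (free z).
  by move=> k; rewrite /= !mulmx0 !addr0.
have r0 (z : 'cV_nx) : r *m z = 0.
  (* One prescribed instant of the zero trajectory fixes x 0 = 0 and v 0 = 0. *)
  have [[[x v] y] [T' [xvy past future]]] :=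
    ctrl _ _ (freeP 0) (freeP z) 1%N isT.
  have xv : state_traj A B x v by move=> k; have [] := xvy k.
  have [x0 v0 _] := past 0%N isT.
  have [<- _ _] := future 0%N.
  rewrite /= -[(1 + T' + 0)%N]add0n (mulmx_state_traj _ _ _ xv).
  rewrite [x 0%N]x0 mulmx0 add0r.
  by apply: big1 => i _; rewrite rB mul0mx.
apply/matrixP => i j.
by have := r0 (delta_mx j 0) => /matrixP /(_ i 0); rewrite -colE !mxE.
Qed.

Lemma persistently_exciting_eq0 (R : realType) (nv T M : nat)
    (v : nat -> 'cV[R]_nv) : persistently_exciting M (restr T v) ->
  forall c : nat -> 'rV[R]_nv,
    (forall j, (j + M <= T)%N -> \sum_(p < M) c p *m v (j + p)%N = 0) ->
    forall p, (p < M)%N -> c p = 0.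
Proof.
move=> [_ rk] c cv p pM.
have free : row_free (hankel M (restr T v)).
  by rewrite /row_free rk sum_nat_const card_ord mulnC.
have /(row_free_inj free) /eq_mxrowP /(_ (Ordinal pM)) // :
  \mxrow_(p < M) c p *m hankel M (restr T v)
  = \mxrow_(p < M) 0 *m hankel M (restr T v).
rewrite [X in _ = X *m _]mxrow0 mul0mx hankel_slab mul_mxrow_mxcol.
apply/matrixP => i j; rewrite !ord1 summxE mxE.
transitivity ((\sum_(p < M) c p *m v (j + p)%N) 0 0).
  by rewrite summxE; apply: eq_bigr => q _; rewrite mulmx_slab slabE.
rewrite cv ?mxE //; have := ltn_ord j; lia.
Qed.

(** A left annihilator of the matrix is a pair as in [annihilator_eq0], read off
    column by column. *)
Lemma willems_row_free (R : realType) (nx nv : nat) (A : 'M[R]_nx)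
    (B : 'M[R]_(nx, nv)) (x : nat -> 'cV[R]_nx) (v : nat -> 'cV[R]_nv) (T L : nat) :
    state_traj A B x v ->
    krylov_full A B ->
    persistently_exciting (L + nx) (restr T v) ->
  row_free (col_mx (hankel L (restr T v)) (slab (T.+1 - L) x 0)).
Proof.
move=> xv ctrl pe; apply: inj_row_free => w.
rewrite -[w]hsubmxK mul_row_col hankel_slab -[lsubmx w]submxrowK mul_mxrow_mxcol.
(* [annihilator_eq0] reads xi only below L, so the default value is harmless. *)
pose xi k : 'rV_nv := if insub k is Some i then submxrow (lsubmx w) i else 0.
move=> w0.
have [] := annihilator_eq0 (T := T) (L := L) (eta := rsubmx w) (xi := xi) xv ctrl.
- exact: persistently_exciting_eq0.
- move=> j jT; have jN : (j < T.+1 - L)%N by lia.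
  have /matrixP /(_ 0 (Ordinal jN)) := w0.
  rewrite mulmx_slab mxE summxE slabE [RHS]mxE addn0 => h.
  apply/matrixP => i k; rewrite !ord1 {i k}.
  rewrite [LHS]mxE summxE [RHS]mxE addrC -[RHS]h; congr (_ + _).
  apply: eq_bigr => i _.
  by rewrite mulmx_slab slabE /xi valK.
move=> -> xi0.
suff -> : \mxrow_i submxrow (lsubmx w) i = 0 by rewrite row_mx0.
rewrite -[RHS]mxrow0; apply: eq_mxrow => i.
by have := xi0 i (ltn_ord i); rewrite /xi valK.
Qed.

(** * The fundamental lemma for spaces of signals *)

Lemma hankel_blockP (R : realType) (nv ny T L : nat)
    (v : nat -> 'cV[R]_nv) (y : nat -> 'cV[R]_ny)
    (fv : 'I_L -> 'cV[R]_nv) (fy : 'I_L -> 'cV[R]_ny) (g : 'cV[R]_(T.+1 - L)) :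
  col_mx (stack fv) (stack fy)
    = col_mx (hankel L (restr T v)) (hankel L (restr T y)) *m g <->
  forall k : 'I_L, fv k = slab _ v k *m g /\ fy k = slab _ y k *m g.
Proof.
rewrite mul_col_mx !hankel_slab !mxcol_mul; split=> [/eq_col_mx [] | vy].
  by move=> /eq_mxcolP vE /eq_mxcolP yE k.
by congr col_mx; apply: eq_mxcol => k; have [] := vy k.
Qed.

(** A family of spaces of vector-valued functions modulo an almost-everywhere
    notion, stable under real matrices.  Countable intersections are needed
    because a trajectory satisfies infinitely many equations, and [signal_ext]
    because restrictions of signals are compared by equality. *)
Record signal_space (R : realType) : Type := SignalSpace {
  signal :> nat -> Type;
  point : Type;
  value : forall n, signal n -> point -> 'cV[R]_n;
  almost : set_system point;
  almost_filter : Filter almost;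
  almost_foralln : forall Q : nat -> set point,
    (forall k, almost (Q k)) -> almost [set w | forall k, Q k w];
  signal_combine : forall m n p (M : 'M[R]_(p, m)) (N : 'M[R]_(p, n))
    (z : signal m) (z' : signal n), exists u : signal p,
    \forall w \near almost, value u w = M *m value z w + N *m value z' w;
  signal_ext : forall n (z z' : signal n),
    (\forall w \near almost, value z w = value z' w) -> z = z' }.

Arguments almost {R} s _.

Section SignalSpace.
Variables (R : realType) (S : signal_space R).

#[local] Instance almost_signal_filter : Filter (almost S) :=
  almost_filter S.

Lemma signal_mulmx m p (M : 'M[R]_(p, m)) (z : S m) : exists u : S p,
  \forall w \near almost S, value u w = M *m value z w.
Proof.
have [u uE] := signal_combine M (0 : 'M[R]_(p, m)) z z.
by exists u; apply: filterS uE => w ->; rewrite mul0mx addr0.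
Qed.

Lemma signal_sum (I : Type) (r : seq I) m n p (M : I -> 'M[R]_(p, m))
    (f : I -> S m) (N : 'M[R]_(p, n)) (z : S n) : exists u : S p,
  \forall w \near almost S,
    value u w = \sum_(i <- r) M i *m value (f i) w + N *m value z w.
Proof.
elim: r => [|i r [u uE]].
  have [u uE] := signal_mulmx N z.
  by exists u; apply: filterS uE => w ->; rewrite big_nil add0r.
have [u' u'E] := signal_combine (M i) 1%:M (f i) u.
exists u'; apply: filterS2 uE u'E => w uE ->.
by rewrite big_cons uE mul1mx addrA.
Qed.

Definition signal_behavior (nx nv ny : nat) (A : 'M[R]_nx) (B : 'M[R]_(nx, nv))
    (C : 'M[R]_(ny, nx)) (D : 'M[R]_(ny, nv)) : set (traj (S nx) (S nv) (S ny)) :=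
  [set c | let: (x, v, y) := c in \forall w \near almost S,
    realization_behavior A B C D (fun k => value (x k) w,
      fun k => value (v k) w, fun k => value (y k) w)].

(** The right inverse of the data matrix turns inputs and initial state into g;
    in the other direction the slabs of the infinite data, applied to g, give a
    trajectory defined for all times. *)
Lemma signal_fundamental_lemma (nx nv ny : nat) (A : 'M[R]_nx)
    (B : 'M[R]_(nx, nv)) (C : 'M[R]_(ny, nx)) (D : 'M[R]_(ny, nv))
    (hctrl : controllable (realization_behavior A B C D)) (T L : nat)
    (v : 'I_T -> 'cV[R]_nv) (y : 'I_T -> 'cV[R]_ny)
    (hvy : restr_io T (manifest (realization_behavior A B C D)) (v, y))
    (hpe : persistently_exciting (L + nx) v)
    (vt : 'I_L -> S nv) (yt : 'I_L -> S ny) :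
  restr_io L (manifest (signal_behavior A B C D)) (vt, yt) <->
  exists g : S (T.+1 - L)%N, \forall w \near almost S,
    col_mx (stack (fun k => value (vt k) w)) (stack (fun k => value (yt k) w))
    = col_mx (hankel L v) (hankel L y) *m value g w.
Proof.
case: hvy => [[v' y'] [x xvy] [? ?]]; subst v y; rewrite /= in xvy hpe *.
have slabx k : slab (T.+1 - L) x k.+1
    = A *m slab (T.+1 - L) x k + B *m slab (T.+1 - L) v' k.
  apply/matrixP => i j; rewrite !mulmx_slab [RHS]mxE !slabE addnS.
  by have [-> _] := xvy (j + k)%N; rewrite mxE.
have slaby k : slab (T.+1 - L) y' k
    = C *m slab (T.+1 - L) x k + D *m slab (T.+1 - L) v' k.
  apply/matrixP => i j; rewrite !mulmx_slab [RHS]mxE !slabE.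
  by have [_ ->] := xvy (j + k)%N; rewrite mxE.
split=> [[[V Y] [X XVY] [? ?]]|[g gE]].
  subst vt yt; rewrite /= in XVY *.
  have free : row_free (col_mx (hankel L (restr T v')) (slab (T.+1 - L) x 0)).
    apply: willems_row_free hpe; last exact: controllable_krylov_full hctrl.
    by move=> k; have [] := xvy k.
  pose K' := pinvmx (col_mx (hankel L (restr T v')) (slab (T.+1 - L) x 0)).
  have [g gE] := signal_sum (index_enum 'I_L) (fun i => submxrow (lsubmx K') i)
    (fun i => V i) (rsubmx K') (X 0%N).
  exists g; apply: filterS2 gE XVY => w gE xvyw.
  have /eq_col_mx [/eq_mxcolP vE x0E] :
      col_mx (\mxcol_(i < L) (slab (T.+1 - L) v' i *m value g w))
             (slab (T.+1 - L) x 0 *m value g w)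
      = col_mx (\mxcol_(i < L) value (V i) w) (value (X 0%N) w).
    rewrite -mxcol_mul -hankel_slab -mul_col_mx gE -mul_mxrow_mxcol submxrowK.
    by rewrite -mul_row_col hsubmxK mulmxA mulmxVp // mul1mx.
  have xE k : (k <= L)%N -> value (X k) w = slab (T.+1 - L) x k *m value g w.
    elim: k => [|k IH] kL; first by rewrite x0E.
    have [-> _] := xvyw k; rewrite slabx mulmxDl -!mulmxA -IH 1?ltnW //.
    by rewrite (vE (Ordinal kL)).
  apply/hankel_blockP => k; rewrite /restr vE; split=> //.
  have [_ ->] := xvyw k; rewrite slaby mulmxDl -!mulmxA -xE 1?ltnW //.
  by rewrite vE.
(* For k >= L the slabs read times beyond the data, where an infinite trajectory
   continuing them is available; this defines the extension of the window. *)
have X k := cid (signal_mulmx (slab (T.+1 - L) x k) g).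
have V k := cid (signal_mulmx (slab (T.+1 - L) v' k) g).
have Y k := cid (signal_mulmx (slab (T.+1 - L) y' k) g).
exists (fun k => sval (V k), fun k => sval (Y k)).
  exists (fun k => sval (X k)); rewrite /signal_behavior /=.
  apply: filterS3 (almost_foralln (fun k => svalP (X k)))
    (almost_foralln (fun k => svalP (V k)))
    (almost_foralln (fun k => svalP (Y k))) => w Xw Vw Yw k.
  by rewrite !Xw Vw Yw slabx slaby !mulmxDl !mulmxA.
by congr (_, _); apply/funext => k; apply: signal_ext;
  [apply: filterS2 gE (svalP (V k))|apply: filterS2 gE (svalP (Y k))] => w;
  move=> /hankel_blockP /(_ k) [] vE yE E; rewrite /restr E.
Qed.

End SignalSpace.

(** * Square summable sequences *)

Definition square_summable (R : realType) (s : nat -> R) : Prop :=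
  (\sum_(0 <= i <oo) (s i ^+ 2)%:E < +oo)%E.

Lemma square_summable0 (R : realType) : square_summable (fun=> 0 : R).
Proof. by rewrite /square_summable eseries0 // => i _ _; rewrite expr0n. Qed.

Lemma square_summableZ (R : realType) (a : R) (s : nat -> R) :
  square_summable s -> square_summable (fun i => a * s i).
Proof.
rewrite /square_summable => s2.
under eq_eseriesr do rewrite exprMn EFinM.
rewrite nneseriesZl => [|i _]; last by rewrite lee_fin sqr_ge0.
by rewrite lte_mul_pinfty // lee_fin sqr_ge0.
Qed.

Lemma square_summableD (R : realType) (s t : nat -> R) :
  square_summable s -> square_summable t -> square_summable (fun i => s i + t i).
Proof.
rewrite /square_summable => s2 t2.
(* (s + t)^2 <= 2 s^2 + 2 t^2, with the factor 2 supplied by scaling. *)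
have := lte_add_pinfty (square_summableZ (Num.sqrt 2) s2)
  (square_summableZ (Num.sqrt 2) t2).
rewrite -nneseriesD; [|by move=> *; rewrite lee_fin sqr_ge0..].
apply: le_lt_trans; apply: lee_nneseries => [i _ _|i _].
  by rewrite lee_fin sqr_ge0.
rewrite -EFinD lee_fin !exprMn sqr_sqrtr //.
have := sqr_ge0 (s i - t i); nra.
Qed.

Lemma square_summable_sum (R : realType) (I : Type) (r : seq I) (s : I -> nat -> R) :
  (forall k, square_summable (s k)) ->
  square_summable (fun i => \sum_(k <- r) s k i).
Proof.
move=> s2; elim: r => [|k r IH].
  by under eq_fun do rewrite big_nil; exact: square_summable0.
by under eq_fun do rewrite big_cons; exact: square_summableD.
Qed.

Lemma ell2_square_summable (R : realType) (n : nat) (z : nat -> 'cV[R]_n) :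
  (\sum_(0 <= i <oo) (((z i)^T *m z i) 0 0)%:E < +oo)%E <->
  forall j, square_summable (fun i => z i j 0).
Proof.
have -> : (\sum_(0 <= i <oo) (((z i)^T *m z i) 0 0)%:E
    = \sum_j \sum_(0 <= i <oo) (z i j 0 ^+ 2)%:E)%E.
  rewrite -nneseries_sum => [|j i _]; last by rewrite lee_fin sqr_ge0.
  apply: eq_eseriesr => i _; rewrite mxE -sumEFin.
  by apply: eq_bigr => j _; rewrite mxE expr2.
split=> [fin j|fin]; last by apply: lte_sum_pinfty => j _; exact: fin.
apply: le_lt_trans fin; rewrite (bigD1 j) //= leeDl //.
by apply: sume_ge0 => k _; apply: nneseries_ge0 => i _ _; rewrite lee_fin sqr_ge0.
Qed.

Lemma ell2_combine (R : realType) m n p (M : 'M[R]_(p, m)) (N : 'M[R]_(p, n))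
    (z : ell2 R m) (z' : ell2 R n) :
  exists u : ell2 R p, forall i, u i = M *m z i + N *m z' i.
Proof.
suff h : (\sum_(0 <= i <oo)
    (((M *m z i + N *m z' i)^T *m (M *m z i + N *m z' i)) 0 0)%:E < +oo)%E.
  by exists (Ell2 h).
apply/ell2_square_summable => j; under eq_fun do rewrite !mxE.
have z2 := (ell2_square_summable z).1 (ell2_summable z).
have z'2 := (ell2_square_summable z').1 (ell2_summable z').
by apply: square_summableD; apply: square_summable_sum => k;
  exact: square_summableZ.
Qed.

Lemma ell2_ext (R : realType) n (z z' : ell2 R n) : z =1 z' -> z = z'.
Proof.
case: z z' => [z zP] [z' z'P] /= /funext zz'.
by subst z'; congr Ell2; exact: Prop_irrelevance.
Qed.

(** Equality holds at every expansion index, hence the filter of supersets of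
    the whole index set. *)
Program Definition ell2_space (R : realType) : signal_space R :=
  @SignalSpace R (@ell2 R) nat (@ell2_fun R) (globally setT) _ _ _ _.
Next Obligation. by move=> R Q Qk w _ k; exact: Qk. Qed.
Next Obligation.
move=> R m n p M N z z'; have [u uE] := ell2_combine M N z z'.
by exists u => i _; exact: uE.
Qed.
Next Obligation. by move=> R n z z' zz'; apply: ell2_ext => i; exact: zz'. Qed.

(** * Square integrable random vectors *)

Section Lspace.
Context (d : measure_display) (Omega : measurableType d) (R : realType).
Variable mu : {measure set Omega -> \bar R}.

Lemma Lspace_Lfun r (r1 : (1 <= r%:E :> \bar R)%E) (z : LspaceType mu r1) :
  (z : Omega -> R) \in Lfun mu r%:E.
Proof.
apply/andP; split; rewrite inE /=.
  exact: (measurable_funPT (repr (z : {mfun_ mu, Omega >-> measurableTypeR R}))).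
exact: (@Lebesgue_finite _ _ _ _ _ _ z).
Qed.

Lemma Lnorm_ae_eq (r : R) (f g : Omega -> R) : measurable_fun setT f ->
  measurable_fun setT g -> (\forall w \ae mu, f w = g w) ->
  ('N[mu]_r%:E[EFin \o f] = 'N[mu]_r%:E[EFin \o g])%E.
Proof.
move=> mf mg fg; rewrite unlock /Lnorm; congr (_ `^ _)%E.
have mpow (h : Omega -> \bar R) : measurable_fun setT h ->
    measurable_fun setT (fun w => `|h w| `^ r)%E.
  move=> mh; apply: (@measurableT_comp _ _ _ _ _ _ (fun x => x `^ r)%E) => //=.
    exact: (measurableT_comp (measurable_poweR _)).
  exact: measurableT_comp.
apply: ae_eq_integral => //; try by apply: mpow; exact/measurable_EFinP.
by apply: filterS fg => w fgw _; rewrite /= fgw.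
Qed.

(** The canonical representative of the class of f differs from f on a null
    set, which leaves its norm unchanged, hence finite. *)
Lemma Lspace_repr r (r1 : (1 <= r%:E :> \bar R)%E) (f : Omega -> R) :
  f \in Lfun mu r%:E ->
  exists g : LspaceType mu r1,
    \forall w \ae mu, (g : Omega -> R) w = f w.
Proof.
case/andP; rewrite !inE /= => mf ff.
(* The sigma-algebra expected here is convertible to that of [mf], but is
   registered under another display. *)
have mf' : @measurable_fun _ _ Omega (measurableTypeR R) setT f by exact: mf.
pose F : {mfun Omega >-> measurableTypeR R} :=
  HB.pack_for {mfun Omega >-> measurableTypeR R} f
    (@isMeasurableFun.Build _ _ Omega (measurableTypeR R) f mf').
pose Q := {mfun_ mu, Omega >-> measurableTypeR R}.
pose q : Q := (\pi_Q F)%qT.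
have qf : \forall w \ae mu, repr q w = f w.
  have : (\pi_Q (repr q) == \pi_Q F)%qT by rewrite reprK.
  by rewrite eqmodE => /asboolP; apply: filterS => w; exact.
have qfin : finite_norm mu r%:E (repr q : Omega -> R).
  rewrite /finite_norm (Lnorm_ae_eq _ _ mf qf) //.
  exact: (measurable_funPT (repr q)).
by exists (HB.pack_for (LspaceType mu r1) q
  (@isFinLebesgue.Build _ _ _ _ _ _ q qfin)).
Qed.

Lemma Lspace_ext r (r1 : (1 <= r%:E :> \bar R)%E) (z z' : LspaceType mu r1) :
  (\forall w \ae mu, (z : Omega -> R) w = (z' : Omega -> R) w) -> z = z'.
Proof.
move=> zz'.
have zE : (z : {mfun_ mu, Omega >-> measurableTypeR R}) = z'.
  rewrite -[LHS]reprK -[RHS]reprK; apply/eqP; rewrite eqmodE; apply/asboolP.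
  by apply: filterS zz' => w zz' _.
case: z z' zE {zz'} => [z [[zP]]] [z' [[z'P]]] /= zE; subst z'.
by rewrite (Prop_irrelevance zP z'P).
Qed.

End Lspace.

Section L2Space.
Context (d : measure_display) (Omega : measurableType d) (R : realType).
Variable P : probability Omega R.

Lemma L2_combine m n p (M : 'M[R]_(p, m)) (N : 'M[R]_(p, n))
    (z : L2 P m) (z' : L2 P n) : exists u : L2 P p,
  \forall w \ae P, sample u w = M *m sample z w + N *m sample z' w.
Proof.
have [L20 L2lin] := Lfun_submod_closed P (le12e R).
pose f i : Omega -> R := \sum_j M i j *: (z j 0 : Omega -> R)
  + \sum_j N i j *: (z' j 0 : Omega -> R).
have L2sum k (a : 'I_k -> R) (t : L2 P k) :
    \sum_j a j *: (t j 0 : Omega -> R) \in Lfun P (2%:R : R)%:E.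
  elim/big_rec: _ => [|j x _ xL2]; first exact: L20.
  by apply: L2lin => //; exact: Lspace_Lfun.
have fL2 i : f i \in Lfun P (2%:R : R)%:E.
  by rewrite /f -[X in X + _]scale1r; apply: L2lin; exact: L2sum.
have u i := cid (Lspace_repr (le12e R) (fL2 i)).
exists (\col_i sval (u i)).
apply: filterS (filter_forall _ (fun i => svalP (u i))) => w uw; apply/colP => i.
rewrite [LHS]mxE mxE uw /f fctE /= !fct_sumE !mxE.
by congr (_ + _); apply: eq_bigr => j _; rewrite mxE.
Qed.

Lemma L2_ext n (z z' : L2 P n) :
  (\forall w \ae P, sample z w = sample z' w) -> z = z'.
Proof.
move=> zz'; apply/matrixP => i j; rewrite ord1; apply: Lspace_ext.
by apply: filterS zz' => w /colP /(_ i); rewrite !mxE.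
Qed.

(** [sample] evaluates representatives, so all equalities between samples hold
    only almost everywhere. *)
Definition L2_space : signal_space R :=
  @SignalSpace R (@L2 d Omega R P) Omega (@sample d Omega R P)
    (almost_everywhere P) _ (@ae_foralln _ _ _ P) L2_combine L2_ext.
End L2Space.

(** * Expansion coefficients and random variables *)

Theorem lemma18 (R : realType) (nx nv ny : nat)
    (A : 'M[R]_nx) (B : 'M[R]_(nx, nv)) (C : 'M[R]_(ny, nx)) (D : 'M[R]_(ny, nv))
    (d : measure_display) (Omega : measurableType d) (P : probability Omega R)
    (hP : separable_probability P)
    (hctrl : controllable (realization_behavior A B C D))
    (T L : nat) (hT : (0 < T)%N) (hL : (0 < L)%N)
    (v : 'I_T -> 'cV[R]_nv) (y : 'I_T -> 'cV[R]_ny)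
    (hvy : restr_io T (manifest (realization_behavior A B C D)) (v, y))
    (hpe : persistently_exciting (L + nx) v) :
  (forall (vt : 'I_L -> ell2 R nv) (yt : 'I_L -> ell2 R ny),
     restr_io L (manifest (expansion_behavior A B C D)) (vt, yt) <->
     exists g : ell2 R (T.+1 - L), forall i : nat,
       col_mx (stack (fun k => vt k i)) (stack (fun k => yt k i))
       = col_mx (hankel L v) (hankel L y) *m g i) /\
  (forall (Vt : 'I_L -> L2 P nv) (Yt : 'I_L -> L2 P ny),
     restr_io L (manifest (random_behavior A B C D)) (Vt, Yt) <->
     exists G : L2 P (T.+1 - L), {ae P, forall w,
       col_mx (stack (fun k => sample (Vt k) w)) (stack (fun k => sample (Yt k) w))
       = col_mx (hankel L v) (hankel L y) *m sample G w}).
Proof.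
split=> [vt yt|Vt Yt].
  have eqW : signal_behavior (S := ell2_space R) A B C D
      = expansion_behavior A B C D.
    apply/seteqP; split=> -[[x' v'] y'] xvy i; first exact: xvy.
    by move=> _; exact: xvy.
  have := signal_fundamental_lemma (S := ell2_space R) hctrl hvy hpe vt yt.
  rewrite eqW => -[to_g of_g]; split=> [/to_g [g gE]|[g gE]].
    by exists g => i; exact: gE.
  by apply: of_g; exists g => i _; exact: gE.
exact: (signal_fundamental_lemma (S := L2_space P) hctrl hvy hpe Vt Yt).
Qed.
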